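(* There is an $\epsilon > 0$ such that any $\epsilon$-approximate streaming algorithm for Approval-CC or Approval-M needs $\Omega(m)$ space, where $m$ is the number of candidates.
   Context: An election $E=(C,V)$ consists of a set of candidates $C=\{c_1,\dots,c_m\}$ and a collection of voters $V=(v_1,\dots,v_n)$, each with a vote. In an Approval-based election the vote of each voter is a subset of $C$ (the candidates she approves). Let $k\le m$. A committee is a set $S\subseteq C$ of $k$ candidates. Satisfaction: $\alpha(v,c)=1$ if $c$ is approved by $v$, and $\alpha(v,c)=0$ otherwise. A CC-assignment for a committee $S$ is a function $\Phi:V\to S$; an M-assignment is a CC-assignment such that $\lfloor n/k\rfloor\le|\Phi^{-1}(c)|\le\lceil n/k\rceil$ for each $c\in S$. The total satisfaction of $V$ from $S$ under $\Phi$ is $\sum_{v\in V}\alpha(v,\Phi(v))$. The total satisfaction of $V$ from $S$ under the Chamberlin--Courant rule (respectively the Monroe rule) is the maximum of this quantity over all CC-assignments (respectively all M-assignments) $\Phi$. Approval-CC (respectively Approval-M) is the voting rule that, given $E$ and $k$, outputs all size-$k$ committees with the highest total satisfaction under the Chamberlin--Courant (respectively Monroe) rule (the winning committees). A size-$k$ committee is $\epsilon$-winning (for a given rule and an election with $n$ voters) if it is either a winning committee, or it can become a winning committee by changing at most $\epsilon n$ votes. Vote streams: the set of candidates $C$ is known, and the voters $v_1,\dots,v_n$ arrive (vote) one at a time, each exactly once, in arbitrary order; $n$ is the length of the stream. A streaming algorithm is a randomized algorithm that, given $k$, processes the stream in one pass and then outputs a size-$k$ committee; its space is measured in bits. It is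 an $\epsilon$-approximate streaming algorithm for a rule if it returns, with high probability, an $\epsilon$-winning committee for that rule. ''With high probability'' means with probability $1-O(1/n)$. *)

(* Defs.v *)
From HB Require Import structures.
From mathcomp Require Import all_boot all_order all_algebra.
From mathcomp Require Import all_classical all_reals all_analysis.

Set Implicit Arguments.
Unset Strict Implicit.
Unset Printing Implicit Defensive.

Import Order.TTheory GRing.Theory Num.Theory.

(* The candidates are 'I_m, a vote is the set
   {set 'I_m} of approved candidates, and the votes of n voters, in order of
   arrival, form an n.-tuple. *)

Inductive voting_rule := ApprovalCC | ApprovalM.

Section Elections.
Local Open Scope nat_scope.
Variables (m n : nat).
Implicit Types (V : n.-tuple {set 'I_m}) (S : {set 'I_m}).

Definition alpha (v : {set 'I_m}) (c : 'I_m) : nat := (c \in v).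

Definition CC_assignment S (Phi : {ffun 'I_n -> 'I_m}) : bool :=
  [forall i, Phi i \in S].

(* n %/ k + ~~ (k %| n) is the ceiling of n / k when 0 < k. *)
Definition M_assignment (k : nat) S (Phi : {ffun 'I_n -> 'I_m}) : bool :=
  CC_assignment S Phi &&
  [forall c in S,
     n %/ k <= #|[set i | Phi i == c]| <= n %/ k + ~~ (k %| n)].

Definition assignment (r : voting_rule) (k : nat) S Phi : bool :=
  match r with
  | ApprovalCC => CC_assignment S Phi
  | ApprovalM => M_assignment k S Phi
  end.

Definition satisfaction_under V (Phi : {ffun 'I_n -> 'I_m}) : nat :=
  \sum_(i < n) alpha (tnth V i) (Phi i).

(* If #|S| = k > 0 then assignments exist, so the value 0 that \max takes on
   an empty range is not used. *)
Definition satisfaction (r : voting_rule) (k : nat) V S : nat :=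
  \max_(Phi : {ffun 'I_n -> 'I_m} | assignment r k S Phi)
     satisfaction_under V Phi.

Definition winning (r : voting_rule) (k : nat) V S : Prop :=
  #|S| = k /\
  forall T : {set 'I_m}, #|T| = k ->
    satisfaction r k V T <= satisfaction r k V S.

Definition eps_winning (R : realType) (r : voting_rule) (eps : R) (k : nat)
    V S : Prop :=
  #|S| = k /\
  (winning r k V S \/
   exists V' : n.-tuple {set 'I_m},
     ((#|[set i | tnth V i != tnth V' i]|)%:R <= eps * n%:R)%R /\
     winning r k V' S).

End Elections.

Section Streaming.
Local Open Scope nat_scope.

Fixpoint run_from (m : nat) (step : nat -> {set 'I_m} -> seq bool -> seq bool)
    (i : nat) (mem : seq bool) (vs : seq {set 'I_m}) : seq bool :=
  if vs is v :: vs' then run_from step i.+1 (step i v mem) vs' else mem.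

(* A randomized one-pass algorithm for m candidates and committee size k; it
   does not receive the length of the stream. All its randomness is a sample
   w from a probability space. For each w it is deterministic: the memory
   content is a bit string, and sa_step w i v turns the content before the
   arrival of the i-th vote v (counting from 0) into the content after it.
   Since w and i are available at each step, drawing fresh coins at each
   arrival is covered, and so is a random tape that can be reread; neither
   is charged to the memory. *)
Record stream_alg (R : realType) (m k : nat) := StreamAlg {
  sa_disp : measure_display;
  sa_coins : measurableType sa_disp;
  sa_prob : probability sa_coins R;
  sa_init : sa_coins -> seq bool;
  sa_step : sa_coins -> nat -> {set 'I_m} -> seq bool -> seq bool;
  sa_out : sa_coins -> seq bool -> {set 'I_m};
  sa_out_card : forall w mem, #|sa_out w mem| = k;
  sa_measurable : forall (vs : seq {set 'I_m}) (S : {set 'I_m}),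
    measurable
      [set w | sa_out w (run_from (sa_step w) 0 (sa_init w) vs) = S]%classic
}.

Definition memory (R : realType) (m k : nat) (A : stream_alg R m k)
    (w : sa_coins A) (vs : seq {set 'I_m}) : seq bool :=
  run_from (sa_step w) 0 (sa_init w) vs.

Definition output (R : realType) (m k : nat) (A : stream_alg R m k)
    (w : sa_coins A) (vs : seq {set 'I_m}) : {set 'I_m} :=
  sa_out w (memory w vs).

(* Only size-k committees with 0 < k <= m are requested; for k > m the type
   stream_alg R m k is empty. *)
Definition stream_alg_family (R : realType) :=
  forall m k : nat, 0 < k <= m -> stream_alg R m k.

(* The constant K of the failure probability O(1/n) depends only on the
   algorithm: not on m, k, n or the stream. *)
Definition eps_approximate (R : realType) (r : voting_rule) (eps : R)
    (A : stream_alg_family R) : Prop :=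
  exists K : R, forall (m k : nat) (hk : 0 < k <= m) (n : nat)
      (V : n.-tuple {set 'I_m}), 0 < n ->
    ((1 - K / n%:R)%R%:E <=
       sa_prob (A m k hk)
         [set w | eps_winning r eps k V (output w V)]%classic)%E.

(* On some stream of n votes and some outcome of the coins, the memory holds
   at least b bits at some moment (take i V is what has arrived by then). *)
Definition needs_space (R : realType) (m k : nat) (A : stream_alg R m k)
    (n : nat) (b : R) : Prop :=
  exists (V : n.-tuple {set 'I_m}) (w : sa_coins A) (i : nat),
    i <= n /\ (b <= (size (memory w (take i V)))%:R)%R.

End Streaming.

(* Main.v *)
(* For k = 1 both rules choose a candidate with most approvals. Pair up the
   candidates and let the first half of the voters all approve one candidate
   of each pair, which encodes m/2 bits x; the second half all approve both
   candidates of one pair j. One candidate then has n approvals and any other at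
   most about n/2, so an eps-winning committee reveals the bit x_j, and the memory
   at half time is a one-way message for the INDEX problem. The failure
   probability K/n is below 1/32 for large n, so some outcome w of the coins
   fails on at most that fraction of the pairs (x, j). For this w the memory
   determines a decoding of x, and since a fixed z satisfies
   \sum_x 4 ^ #{j | z_j = x_j} = 5 ^ (m/2), few memory contents cannot decode
   all x well. *)
Require Import Defs.
From HB Require Import structures.
From mathcomp Require Import all_boot all_order all_algebra.
From mathcomp Require Import all_classical all_reals all_analysis.
From mathcomp Require Import measurable_realfun zify lra.
Set Implicit Arguments.
Unset Strict Implicit.
Unset Printing Implicit Defensive.
Import Order.TTheory GRing.Theory Num.Theory.

(** * Counting bound for INDEX *)

(** The sum factorises over the coordinates; each factor is 4 + 1, since exactly one bit agrees with
    [z j]. *)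
Lemma sum_exp_agreement (N : nat) (z : {ffun 'I_N -> bool}) :
  \sum_(x : {ffun 'I_N -> bool}) 4 ^ (\sum_j (z j == x j)) = 5 ^ N.
Proof.
transitivity (\sum_(x : {ffun 'I_N -> bool}) \prod_j 4 ^ (z j == x j)).
  by apply: eq_bigr => x _; rewrite expn_sum.
rewrite -(bigA_distr_bigA (fun j b => 4 ^ (z j == b))) /=.
rewrite (eq_bigr (fun=> 5)) ?prod_nat_const ?card_ord // => j _.
by rewrite big_bool; case: (z j).
Qed.

Lemma card_bseq_bool_le (L : nat) : #|{: L.-bseq bool}| <= 2 ^ L.+1.
Proof.
rewrite card_bseq card_bool; elim: L => [|L IH]; first by rewrite big_ord1.
by rewrite big_ord_recr /= (expnS 2 L.+1) mul2n -addnn leq_add2r.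
Qed.

(** Replacing the single string [f x] by all strings of at most [L] bits makes the decoding
    independent of [x]. *)
Lemma sum_exp_agreement_le (N L : nat) (f : {ffun 'I_N -> bool} -> seq bool)
    (g : seq bool -> {ffun 'I_N -> bool}) :
  (forall x, size (f x) <= L) ->
  \sum_x 4 ^ (\sum_j (g (f x) j == x j)) <= 2 ^ L.+1 * 5 ^ N.
Proof.
move=> fL.
apply: (@leq_trans (\sum_(s : L.-bseq bool) \sum_(x : {ffun 'I_N -> bool})
                     4 ^ (\sum_j (g s j == x j)))).
  rewrite exchange_big /=; apply: leq_sum => x _.
  by rewrite (bigD1 (Bseq (fL x))) //= leq_addr.
under eq_bigr do rewrite sum_exp_agreement.
by rewrite sum_nat_const leq_mul2r card_bseq_bool_le orbT.
Qed.

(** Reduces to 125 <= 128. *)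
Lemma exp5_le_exp2 (N : nat) : 5 ^ (3 * N) <= 2 ^ (7 * N).
Proof. by case: N => // N; rewrite !expnM leq_exp2r. Qed.

(* By Markov's inequality, g decodes at least half of the inputs with at most
   N/16 errors; the sum of 4 ^ agreement over these is already too large. *)
Lemma index_lower_bound (N : nat) (f : {ffun 'I_N -> bool} -> seq bool)
    (g : seq bool -> {ffun 'I_N -> bool}) :
  4 < N -> 32 * \sum_x \sum_j (g (f x) j != x j) <= N * 2 ^ N ->
  exists x, N %/ 16 < size (f x).
Proof.
move=> N4 err; apply/existsP; apply: contraT => /existsPn fL.
have {}fL x : size (f x) <= N %/ 16 by rewrite leqNgt.
set d := N %/ 16; have dN : 16 * d <= N by rewrite /d; lia.
pose e x := \sum_j (g (f x) j != x j).
have eE x : \sum_j (g (f x) j == x j) = N - e x.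
  apply/eqP; rewrite -(eqn_add2r (e x)) subnK; last first.
    rewrite -[leqRHS]card_ord -sum1_card; apply: leq_sum => j _; exact: leq_b1.
  rewrite -big_split /= -[eqbRHS]card_ord -sum1_card; apply/eqP.
  by apply: eq_bigr => j _; case: eqP.
pose bad := [set x | d < e x].
have badE : 2 * #|bad| <= 2 ^ N.
  (* A bad [x] has [e x >= d + 1], hence [16 * e x >= N] although [d] is rounded down. *)
  have H : #|bad| * N <= 16 * \sum_x e x.
    rewrite -sum_nat_const big_distrr /= [leqRHS](bigID (mem bad)) /=.
    apply: leq_trans (leq_addr _ _); apply: leq_sum => x.
    by rewrite inE /d; lia.
  rewrite -(@leq_pmul2r N); last by lia.
  by move: err H; rewrite -/(\sum_x e x) ; lia.
have goodE : 2 ^ N <= 2 * #|~: bad|.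
  by have := cardsC bad; rewrite card_ffun card_bool card_ord; lia.
have := sum_exp_agreement_le g fL; rewrite -/d => up.
have low : #|~: bad| * 4 ^ (N - d) <= 2 ^ d.+1 * 5 ^ N.
  apply: leq_trans up; rewrite -sum_nat_const [leqRHS](bigID (mem (~: bad))) /=.
  apply: leq_trans (leq_addr _ _); apply: leq_sum => x.
  by rewrite eE !inE -leqNgt leq_exp2l //; lia.
have : 2 ^ (N + 2 * (N - d)) <= 2 ^ d.+2 * 5 ^ N.
  rewrite expnD expnM (expnS 2 d.+1) -mulnA.
  apply: leq_trans (leq_mul goodE (leqnn _)) _.
  by rewrite -mulnA leq_mul2l low orbT.
(* Cubing turns the power of 5 into a power of 2. Comparing exponents leaves 2N <= 9d + 6, which
   contradicts 16d <= N once N > 4. *)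
rewrite -(@leq_exp2r _ _ 3) // expnMn -!expnM (mulnC N 3) => H.
have := leq_trans H (leq_mul (leqnn _) (exp5_le_exp2 N)).
by rewrite -expnD leq_exp2l //; lia.
Qed.

(** Averaging: the expected number of events that occur is at least [(1 - a) * #|I|], so it cannot
    be below [(1 - b) * #|I|] at every [w]. *)
Lemma exists_few_failures (R : realType) (d : measure_display)
    (T : measurableType d) (P : probability T R) (I : finType) (E : I -> set T)
    (a b : R) :
  0 < #|I| -> (a < b)%R ->
  (forall i, measurable (E i)) -> (forall i, ((1 - a)%R%:E <= P (E i))%E) ->
  exists w, ((#|[set i | w \notin E i]|)%:R <= b * #|I|%:R)%R.
Proof.
move=> I0 ab mE PE; apply/not_existsP => /= H.
pose X w : R := (\sum_i \1_(E i) w)%R.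
have X0 w : (0 <= X w)%R by apply: sumr_ge0 => i _; rewrite indicE.
have XE w : X w = (#|I|%:R - #|[set i | w \notin E i]|%:R)%R.
  have -> : X w = #|[set i | w \in E i]|%:R%R.
    by rewrite -sum1_card natr_sum big_mkcond /=; apply: eq_bigr => i _;
       rewrite indicE inE; case: ifP.
  rewrite -(cardsC [set i | w \in E i]) natrD; set A := (X in (_ - X%:R)%R).
  have -> : ~: [set i | w \in E i] = [set i | w \notin E i].
    by apply/setP => i; rewrite !inE.
  by rewrite addrK.
have Xle w : (X w <= (1 - b) * #|I|%:R)%R.
  rewrite XE; have /negP := H w; rewrite -ltNge; lra.
have mX : measurable_fun setT X.
  by apply: measurable_sum => i; apply: measurable_indic.
have intX : (\int[P]_w (X w)%:E = \sum_i P (E i))%E.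
  under eq_integral do rewrite /X -sumEFin.
  rewrite ge0_integral_sum //.
  - by apply: eq_bigr => i _; rewrite integral_indic // setIT.
  - by move=> i; apply/measurable_EFinP/measurable_indic.
have up : (\int[P]_w (X w)%:E <= ((1 - b) * #|I|%:R)%:E)%E.
  rewrite -[leRHS]mule1 -(@probability_setT _ _ _ P) -integral_cst //.
  apply: ge0_le_integral => //.
  - by move=> w _; rewrite lee_fin.
  - exact/measurable_EFinP.
  - by move=> w _; rewrite lee_fin.
have low : (((1 - a) * #|I|%:R)%:E <= \int[P]_w (X w)%:E)%E.
  rewrite intX; apply: (@le_trans _ _ (\sum_(i : I) (1 - a)%:E)%E).
    by rewrite sumEFin sumr_const mulr_natr.
  by apply: lee_sum => i _; exact: PE.
have := le_trans low up; rewrite lee_fin ler_pM2r ?ltr0n //; lra.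
Qed.

(** * Approval elections with one-candidate committees *)

Definition approvals (m : nat) (vs : seq {set 'I_m}) (c : 'I_m) : nat :=
  count (fun v : {set 'I_m} => c \in v) vs.

Lemma approvalsE (m n : nat) (V : n.-tuple {set 'I_m}) (c : 'I_m) :
  approvals V c = \sum_(i < n) (c \in tnth V i).
Proof. by rewrite /approvals -sum1_count big_mkcond big_tuple. Qed.

(** The constant assignment is the only one, and it meets the Monroe bounds, which both equal [n];
    so the two rules coincide here. *)
Lemma satisfaction_set1 (r : voting_rule) (m n : nat)
    (V : n.-tuple {set 'I_m}) (c : 'I_m) :
  satisfaction r 1 V [set c] = approvals V c.
Proof.
have CCE (Phi : {ffun 'I_n -> 'I_m}) :
    CC_assignment [set c] Phi = (Phi == [ffun=> c]).
  apply/forallP/eqP => [H|-> i]; last by rewrite ffunE inE.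
  by apply/ffunP => i; have := H i; rewrite ffunE inE => /eqP.
have assE (Phi : {ffun 'I_n -> 'I_m}) :
    assignment r 1 [set c] Phi = (Phi == [ffun=> c]).
  case: r; rewrite /= ?/M_assignment CCE //; case: eqP => //= ->.
  apply/forall_inP => _ /set1P ->; rewrite divn1 dvd1n addn0.
  suff -> : [set i : 'I_n | [ffun=> c] i == c] = [set: 'I_n].
    by rewrite cardsT card_ord leqnn.
  by apply/setP => i; rewrite !inE ffunE eqxx.
rewrite /satisfaction (eq_bigl _ _ assE) big_pred1_eq approvalsE.
by apply: eq_bigr => i _; rewrite ffunE.
Qed.

Lemma approvals_change (m n : nat) (V V' : n.-tuple {set 'I_m}) (c : 'I_m) :
  approvals V' c <= approvals V c + #|[set i | tnth V i != tnth V' i]|.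
Proof.
rewrite !approvalsE -sum1_card [X in _ + X]big_mkcond -big_split /=.
apply: leq_sum => i _; rewrite inE; case: eqP => [->|_] /=.
  exact: leq_addr.
exact: leq_trans (leq_b1 _) (leq_addl _ _).
Qed.

(** The factor 2 arises because the changed votes may both lower the count of [a] and raise that of
    [c]. *)
Lemma eps_winning_set1 (R : realType) (r : voting_rule) (eps : R) (m n : nat)
    (V : n.-tuple {set 'I_m}) (S : {set 'I_m}) :
  (0 <= eps)%R -> eps_winning r eps 1 V S ->
  exists2 c, S = [set c] & forall a,
    ((approvals V a)%:R <= (approvals V c)%:R + 2 * eps * n%:R)%R.
Proof.
move=> eps0 [/eqP /cards1P [c ->] win]; exists c => // a.
have opt V' : winning r 1 V' [set c] -> approvals V' a <= approvals V' c.
  by case=> _ /(_ [set a]); rewrite !satisfaction_set1 cards1; apply.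
case: win => [/opt|[V' [close /opt le_ac]]].
  by rewrite -(ler_nat R) => /le_trans; apply; rewrite lerDl !mulr_ge0.
have := approvals_change V V' c; have := approvals_change V' V a.
under eq_finset do rewrite eq_sym.
set t := #|_| in close *; move: le_ac.
rewrite -!(ler_nat R) !natrD; lra.
Qed.

(** * INDEX instances as vote streams *)

Lemma split_stream_subproof (n : nat) (T : Type) (u v : T) :
  size (nseq n./2 u ++ nseq (n - n./2) v) == n.
Proof. by rewrite size_cat !size_nseq; lia. Qed.

Definition split_stream (n : nat) (T : Type) (u v : T) : n.-tuple T :=
  Tuple (split_stream_subproof n u v).

Lemma take_split_stream (n : nat) (T : Type) (u v : T) :
  take n./2 (split_stream n u v) = nseq n./2 u.
Proof. by rewrite take_size_cat // size_nseq. Qed.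

(** As [a] has [n] approvals, the chosen candidate has at least 3n/4. Missing [X] or [Y] leaves at
    most (n + 1)/2, which is smaller for n > 2. *)
Lemma split_stream_eps_winning (R : realType) (r : voting_rule) (m n : nat)
    (X Y S : {set 'I_m}) (a : 'I_m) :
  2 < n -> X :&: Y = [set a] ->
  eps_winning r (1 / 8%:R : R)%R 1 (split_stream n X Y) S -> S = [set a].
Proof.
move=> n2 XY /eps_winning_set1 [|c -> /(_ a)]; first lra.
have appE b : approvals (split_stream n X Y) b =
    (b \in X) * n./2 + (b \in Y) * (n - n./2).
  by rewrite /approvals count_cat !count_nseq.
have : a \in X :&: Y by rewrite XY set11.
rewrite inE => /andP[aX aY] H.
have {}H : 4 * n <= 4 * approvals (split_stream n X Y) c + n.
  have appa : approvals (split_stream n X Y) a = n by rewrite appE aX aY; lia.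
  by rewrite -(ler_nat R) natrD !natrM; move: H; rewrite appa; lra.
move: H; rewrite appE => H.
suff : c \in X :&: Y by rewrite XY => /set1P ->.
by rewrite inE; move: H; case: (c \in X); case: (c \in Y) => //=; lia.
Qed.

Lemma candidate_subproof (m : nat) (j : 'I_m./2) (b : bool) : j.*2 + b < m.
Proof. by have := ltn_ord j; case: b; lia. Qed.

(** For odd [m] the last candidate lies in no pair. *)
Definition candidate (m : nat) (j : 'I_m./2) (b : bool) : 'I_m :=
  Ordinal (candidate_subproof j b).

Lemma candidate_inj (m : nat) (i j : 'I_m./2) (b b' : bool) :
  candidate i b = candidate j b' -> i = j /\ b = b'.
Proof.
move=> /(congr1 val) /= H; split; last by move: H; case: b; case: b'; lia.
by apply: val_inj; move: H; case: b; case: b' => /=; lia.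
Qed.

Definition bits_vote (m : nat) (x : {ffun 'I_m./2 -> bool}) : {set 'I_m} :=
  [set candidate j (x j) | j : 'I_m./2].

Definition query_vote (m : nat) (j : 'I_m./2) : {set 'I_m} :=
  [set candidate j b | b : bool].

Lemma bits_query_vote (m : nat) (x : {ffun 'I_m./2 -> bool}) (j : 'I_m./2) :
  bits_vote x :&: query_vote j = [set candidate j (x j)].
Proof.
apply/setP => c; rewrite !inE; apply/andP/eqP => [[]|->].
  by case/imsetP => i _ -> /imsetP [b _] /candidate_inj [-> _].
by split; apply/imsetP; [exists j | exists (x j)].
Qed.

Lemma run_from_cat (m : nat)
    (step : nat -> {set 'I_m} -> seq bool -> seq bool) (i : nat)
    (mem : seq bool) (s t : seq {set 'I_m}) :
  run_from step i mem (s ++ t) =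
  run_from step (i + size s) (run_from step i mem s) t.
Proof.
elim: s i mem => [|v s IH] i mem /=; first by rewrite addn0.
by rewrite IH addSnnS.
Qed.

(** There are finitely many committees, so the event is a finite union of the sets in
    [sa_measurable]. *)
Lemma measurable_output (R : realType) (m k : nat) (A : stream_alg R m k)
    (vs : seq {set 'I_m}) (Q : {set 'I_m} -> Prop) :
  measurable [set w : sa_coins A | Q (output w vs)]%classic.
Proof.
rewrite (_ : [set w | _]%classic =
    (\bigcup_(S in Q) [set w : sa_coins A | output w vs = S])%classic).
  apply: fin_bigcup_measurable => [|S _]; last exact: sa_measurable.
  exact: finite_finset.
by apply/seteqP; split => [w Qw|w [S QS /= ->] //]; exists (output w vs).
Qed.

Theorem theorem5 (R : realType) :
  exists eps : R, (0 < eps)%R /\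
  exists c : R, (0 < c)%R /\
    forall (r : voting_rule) (A : stream_alg_family R),
      eps_approximate r eps A ->
      exists m0 n0 : nat,
        forall m n : nat, (m0 <= m)%N -> (n0 <= n)%N ->
          exists (k : nat) (hk : (0 < k <= m)%N),
            needs_space (A m k hk) n (c * m%:R)%R.
Proof.
exists (1 / 8%:R)%R; split; first lra.
exists (1 / 32%:R)%R; split; first lra.
move=> r A [K approx].
(* These bounds give [4 < m./2], [2 < n] and [32 * K < n]. *)
exists 10, (maxn 3 (Num.bound (32%:R * K)%R)) => m n m10.
rewrite geq_max => /andP[n2 nK].
have hk : 0 < 1 <= m by lia.
exists 1, hk.
have n0 : (0 < n%:R :> R)%R by rewrite ltr0n; lia.
have Kn : (K / n%:R < 1 / 32%:R)%R.
  rewrite ltr_pdivrMr //.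
  suff : (32%:R * K < n%:R)%R by lra.
  (* [K] may be negative, while [archi_boundP] asks for a nonnegative argument. *)
  have [K0|K0] := ltP (32%:R * K)%R 0%R; first exact: lt_trans n0.
  by apply: lt_le_trans (archi_boundP K0) _; rewrite ler_nat.
pose E (xj : {ffun 'I_m./2 -> bool} * 'I_m./2) :=
  [set w : sa_coins (A m 1 hk) |
    output w (split_stream n (bits_vote xj.1) (query_vote xj.2)) =
      [set candidate xj.2 (xj.1 xj.2)]%SET]%classic.
have mE xj : measurable (E xj).
  exact: (@measurable_output _ _ _ (A m 1 hk) _
    (eq^~ [set candidate xj.2 (xj.1 xj.2)])).
have PE xj : ((1 - K / n%:R)%:E <= sa_prob (A m 1%N hk) (E xj))%E.
  pose V := split_stream n (bits_vote xj.1) (query_vote xj.2).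
  apply: le_trans (approx m 1 hk n V (ltnW (ltnW n2))) _.
  apply: le_measure; rewrite ?inE //.
    exact: (@measurable_output _ _ _ (A m 1 hk) V
      (eps_winning r (1 / 8%:R : R)%R 1 V)).
  by move=> w /= /split_stream_eps_winning; apply => //; exact: bits_query_vote.
have I0 : 0 < #|{: {ffun 'I_m./2 -> bool} * 'I_m./2}|.
  by rewrite card_prod card_ffun card_bool card_ord muln_gt0 expn_gt0; lia.
have [w] := exists_few_failures I0 Kn mE PE.
rewrite card_prod card_ffun card_bool card_ord => few.
pose f x := memory w (nseq n./2 (bits_vote x)).
(* The decoder resumes the run from memory [s] at arrival [n./2], once for each query [j], with the
   same coins [w]. *)
pose g s := [ffun j : 'I_m./2 => candidate j true \in
  sa_out w (run_from (sa_step w) n./2 s (nseq (n - n./2) (query_vote j)))].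
have gE x j : w \in E (x, j) -> g (f x) j = x j.
  rewrite inE /E /= /output /memory run_from_cat size_nseq ffunE => ->.
  by rewrite inE; apply/eqP/idP => [/candidate_inj [] //|->].
have [||x fx] := @index_lower_bound m./2 f g; first by lia.
  (* Each wrongly decoded bit is charged to a failing pair [(x, j)]. *)
  apply: (@leq_trans (32 * #|[set xj | w \notin E xj]|)).
    rewrite leq_mul2l pair_big /= -sum1_card [leqRHS]big_mkcond /=.
    apply: leq_sum => -[x j] _ /=; rewrite inE.
    by have [/gE ->|] := boolP (w \in E (x, j)); rewrite ?eqxx ?leq_b1.
  by rewrite mulnC -(ler_nat R) !natrM; move: few; rewrite natrM; lra.
exists (split_stream n (bits_vote x) finset.set0), w, n./2; split; first by lia.
rewrite take_split_stream -/(f x).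
(* The strict bound [m./2 %/ 16 < size (f x)] absorbs both roundings. *)
have : m <= 32 * size (f x) by lia.
by rewrite -(ler_nat R) natrM; lra.
Qed.
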